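(* Let $R$ be a commutative ring with unity, let $M$ be an $R$-module, and let $N$ be a Noetherian $R$-module. Then the existence of an injection in $\operatorname{Hom}_R(N,M)$ is a local property; that is, $\operatorname{Hom}_R(N,M)$ contains an injective map if and only if, for every prime ideal $\mathfrak p$ of $R$, the localization $\operatorname{Hom}_R(N,M)_{\mathfrak p}$ contains an element whose induced map $N_{\mathfrak p}\to M_{\mathfrak p}$ is injective.
   Context: $R$-modules are not assumed finitely generated unless stated; $N$ is Noetherian as an $R$-module, but $R$ itself need not be Noetherian. For a prime $\mathfrak p$ of $R$, an element $h/s$ of $\operatorname{Hom}_R(N,M)_{\mathfrak p}$ (with $h\in\operatorname{Hom}_R(N,M)$, $s\in R\setminus\mathfrak p$) is viewed as the $R_{\mathfrak p}$-linear map $N_{\mathfrak p}\to M_{\mathfrak p}$ given by $\frac{1}{s}h_{\mathfrak p}$, where $h_{\mathfrak p}$ is the localization of $h$. *)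

(* Defs.v *)
From HB Require Import structures.
From mathcomp Require Import all_boot all_algebra.
From mathcomp Require Import boolp prodnormedzmodule ring.

Set Implicit Arguments.
Unset Strict Implicit.
Unset Printing Implicit Defensive.

Import GRing.Theory.
Local Open Scope ring_scope.
Local Open Scope quotient_scope.

(* Commutative rings are [comPzRingType]s, so that the zero ring is allowed.
   Boolean predicates represent arbitrary subsets, thanks to the classical
   axioms of [boolp]. *)

Definition finitely_generated (R : pzRingType) (N : lmodType R)
    (U : {pred N}) : Prop :=
  exists s : seq N, forall u,
    u \in U <-> exists c : 'I_(size s) -> R, u = \sum_(i < size s) c i *: s`_i.

Definition noetherian (R : pzRingType) (N : lmodType R) : Prop :=
  forall U : {pred N}, submod_closed U -> finitely_generated U.

(* The prime ideals of MathComp's [ring_quotient] exist only over rings with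
   [1 != 0]; see [is_prime_idealE] for the agreement over such rings. *)
Definition is_prime_ideal (R : comPzRingType) (p : {pred R}) : Prop :=
  [/\ 0 \in p, 1 \notin p, forall a, {in p &, forall u v, a * u + v \in p}
    & forall u v, u * v \in p -> (u \in p) || (v \in p)].

Lemma is_prime_idealE (R : comNzRingType) (p : {pred R}) :
  is_prime_ideal p <-> idealr_closed p /\ prime_idealr_closed p.
Proof. by split=> [[? ? ? ?]|[[? ? ?] ?]]; split. Qed.

Record prime_ideal (R : comPzRingType) := PrimeIdeal {
  prime_ideal_pred :> {pred R};
  prime_idealP : is_prime_ideal prime_ideal_pred }.

Definition prime_compl (R : comPzRingType) (p : prime_ideal R) : {pred R} :=
  [predC p].

Fact prime_compl_mulr_closed (R : comPzRingType) (p : prime_ideal R) :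
  mulr_closed (prime_compl p).
Proof.
case: (prime_idealP p) => _ p1 _ pM; split=> [|u v up vp]; first by rewrite inE.
move: up vp; rewrite !inE => up vp; apply/negP => /pM.
by rewrite (negbTE up) (negbTE vp).
Qed.
HB.instance Definition _ (R : comPzRingType) (p : prime_ideal R) :=
  GRing.isMulClosed.Build R (prime_compl p) (prime_compl_mulr_closed p).

Section Localization.
Variables (R : comPzRingType) (S : mulrClosed R).

Record ldenom := Denom { dval : R; ldenomP : dval \in S }.
HB.instance Definition _ := [isSub for dval].
HB.instance Definition _ := [Choice of ldenom by <:].

Definition ldenom1 : ldenom := Denom (rpred1 S).
Definition ldenomM (s t : ldenom) : ldenom :=
  Denom (rpredM (ldenomP s) (ldenomP t)).

Section Module.
Variable M : lmodType R.

Definition lfrac_eq (x y : M * ldenom) : bool :=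
  `[< exists2 u, u \in S & u *: (dval y.2 *: x.1) = u *: (dval x.2 *: y.1) >].

Fact lfrac_eq_equiv : equiv_class_of lfrac_eq.
Proof.
split=> [x|x y|y x z].
- by apply/asboolP; exists 1; rewrite ?rpred1.
- by apply/asboolP/asboolP => -[u Su e]; exists u.
move=> /asboolP[u Su e] /asboolP[v Sv f]; apply/asboolP.
exists (u * v * dval y.2); first by rewrite !rpredM // (ldenomP y.2).
transitivity ((v * dval z.2) *: (u *: (dval y.2 *: x.1))).
  by rewrite !scalerA; congr (_ *: _); ring.
rewrite e; transitivity ((u * dval x.2) *: (v *: (dval z.2 *: y.1))).
  by rewrite !scalerA; congr (_ *: _); ring.
by rewrite f !scalerA; congr (_ *: _); ring.
Qed.

Canonical lfrac_eq_equivRel := EquivRelPack lfrac_eq_equiv.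
Canonical lfrac_eq_encModRel := defaultEncModRel lfrac_eq.

Definition loc := {eq_quot lfrac_eq}.
HB.instance Definition _ := EqQuotient.on loc.
HB.instance Definition _ := Choice.on loc.

Definition lfrac (m : M) (s : ldenom) : loc := \pi_loc (m, s).

Lemma lfracP (x : loc) : exists m s, x = lfrac m s.
Proof.
by exists (repr x).1, (repr x).2; rewrite /lfrac -surjective_pairing reprK.
Qed.

Lemma eq_lfrac m s n t :
  lfrac m s = lfrac n t <->
  exists2 u, u \in S & u *: (dval t *: m) = u *: (dval s *: n).
Proof.
rewrite /lfrac; split=> [/eqquotP/asboolP //|e].
by apply/eqquotP/asboolP.
Qed.

Lemma lfrac_repr (x : loc) : lfrac (repr x).1 (repr x).2 = x.
Proof. by rewrite /lfrac -surjective_pairing reprK. Qed.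

Lemma lfrac_expand u (Su : u \in S) m s :
  lfrac (u *: m) (ldenomM (Denom Su) s) = lfrac m s.
Proof.
by apply/eq_lfrac; exists 1; rewrite ?rpred1 // !scale1r !scalerA /=;
  congr (_ *: _); ring.
Qed.

Definition loc_add (x y : loc) : loc :=
  lfrac (dval (repr y).2 *: (repr x).1 + dval (repr x).2 *: (repr y).1)
        (ldenomM (repr x).2 (repr y).2).

Lemma loc_addE m s n t :
  loc_add (lfrac m s) (lfrac n t) =
    lfrac (dval t *: m + dval s *: n) (ldenomM s t).
Proof.
rewrite /loc_add; have /eq_lfrac := lfrac_repr (lfrac m s).
have /eq_lfrac := lfrac_repr (lfrac n t).
case: (repr _) => [n' t'] /= [v Sv f]; case: (repr _) => [m' s'] /= [u Su e].
apply/eq_lfrac; exists (u * v); rewrite ?rpredM //= !scalerDr.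
congr (_ + _).
  transitivity ((v * dval t * dval t') *: (u *: (dval s *: m'))).
    by rewrite !scalerA; congr (_ *: _); ring.
  by rewrite e !scalerA; congr (_ *: _); ring.
transitivity ((u * dval s * dval s') *: (v *: (dval t *: n'))).
  by rewrite !scalerA; congr (_ *: _); ring.
by rewrite f !scalerA; congr (_ *: _); ring.
Qed.

Definition loc_opp (x : loc) : loc := lfrac (- (repr x).1) (repr x).2.

Lemma loc_oppE m s : loc_opp (lfrac m s) = lfrac (- m) s.
Proof.
rewrite /loc_opp; have /eq_lfrac := lfrac_repr (lfrac m s).
case: (repr _) => [m' s'] /= [u Su e].
by apply/eq_lfrac; exists u; rewrite // !scalerN e.
Qed.

Fact loc_addA : associative loc_add.
Proof.
move=> x y z; have [m [s ->]] := lfracP x; have [n [t ->]] := lfracP y.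
have [l [r ->]] := lfracP z; rewrite !loc_addE; apply/eq_lfrac.
exists 1; rewrite ?rpred1 // !scale1r /= !scalerDr !scalerA addrA.
by congr (_ *: _ + _ *: _ + _ *: _); ring.
Qed.

Fact loc_addC : commutative loc_add.
Proof.
move=> x y; have [m [s ->]] := lfracP x; have [n [t ->]] := lfracP y.
rewrite !loc_addE addrC; apply/eq_lfrac; exists 1; rewrite ?rpred1 //=.
by rewrite mulrC.
Qed.

Fact loc_add0 : left_id (lfrac 0 ldenom1) loc_add.
Proof.
move=> x; have [m [s ->]] := lfracP x.
rewrite loc_addE scaler0 add0r; apply/eq_lfrac; exists 1; rewrite ?rpred1 //=.
by rewrite !scale1r mul1r.
Qed.

Fact loc_addN : left_inverse (lfrac 0 ldenom1) loc_opp loc_add.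
Proof.
move=> x; have [m [s ->]] := lfracP x.
rewrite loc_oppE loc_addE scalerN addNr; apply/eq_lfrac.
by exists 1; rewrite ?rpred1 // !scaler0.
Qed.

HB.instance Definition _ :=
  GRing.isZmodule.Build loc loc_addA loc_addC loc_add0 loc_addN.

Lemma lfracD m s n t :
  lfrac m s + lfrac n t = lfrac (dval t *: m + dval s *: n) (ldenomM s t).
Proof. exact: loc_addE. Qed.

Lemma lfracN m s : - lfrac m s = lfrac (- m) s. Proof. exact: loc_oppE. Qed.

Lemma lfrac0 s : lfrac 0 s = 0.
Proof. by apply/eq_lfrac; exists 1; rewrite ?rpred1 // !scaler0. Qed.

Lemma lfrac_eq0 m s : lfrac m s = 0 <-> exists2 u, u \in S & u *: m = 0.
Proof.
split=> [/eq_lfrac[u Su]|[u Su e]]; last first.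
  by apply/eq_lfrac; exists u; rewrite //= scale1r e !scaler0.
by rewrite /= scale1r !scaler0; exists u.
Qed.

Lemma lfrac_addl m n s : lfrac (m + n) s = lfrac m s + lfrac n s.
Proof.
rewrite lfracD -scalerDr; apply/eq_lfrac; exists 1; rewrite ?rpred1 //=.
by rewrite !scale1r !scalerA; congr (_ *: _); ring.
Qed.

End Module.

(* Multiplication by fractions of scalars, with [R] viewed as the module [R^o]
   over itself; below it provides both the product of the localized ring and
   its action on localized modules. *)
Definition lfrac_mul (M : lmodType R) (a : loc R^o) (x : loc M) : loc M :=
  lfrac (((repr a).1 : R) *: (repr x).1) (ldenomM (repr a).2 (repr x).2).

Lemma lfrac_mulE (M : lmodType R) (a : R) s (m : M) t :
  lfrac_mul (lfrac (a : R^o) s) (lfrac m t) = lfrac (a *: m) (ldenomM s t).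
Proof.
rewrite /lfrac_mul.
have /eq_lfrac := lfrac_repr (lfrac m t).
have /eq_lfrac := lfrac_repr (lfrac (a : R^o) s).
case: (repr _) => [b s'] /= [v Sv f]; case: (repr _) => [m' t'] /= [u Su e].
apply/eq_lfrac; exists (u * v); rewrite ?rpredM //=.
transitivity ((v * (dval s * b)) *: (u *: (dval t *: m'))).
  by rewrite !scalerA; congr (_ *: _); ring.
have {}f : v * (dval s * (b : R)) = v * (dval s' * a) := f.
by rewrite e f !scalerA; congr (_ *: _); ring.
Qed.

Definition loc_ring := loc R^o.
HB.instance Definition _ := GRing.Zmodule.on loc_ring.

Fact loc_mulA (M : lmodType R) (a b : loc_ring) (x : loc M) :
  lfrac_mul a (lfrac_mul b x) = lfrac_mul (lfrac_mul a b) x.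
Proof.
have [a' [s ->]] := lfracP a; have [b' [t ->]] := lfracP b.
have [m [r ->]] := lfracP x.
rewrite (lfrac_mulE b' t m r) (lfrac_mulE a' s b' t) !lfrac_mulE.
apply/eq_lfrac; exists 1; rewrite ?rpred1 //= !scale1r !scalerA; congr (_ *: _).
by rewrite -[a' *: b']/(a' * b' : R); ring.
Qed.

Fact loc_mulC : commutative (@lfrac_mul R^o).
Proof.
move=> a b; have [a' [s ->]] := lfracP a; have [b' [t ->]] := lfracP b.
rewrite !lfrac_mulE; apply/eq_lfrac; exists 1; rewrite ?rpred1 //=.
by rewrite [dval t * _]mulrC -[a' *: b']/(a' * b' : R) [a' * b']mulrC.
Qed.

Fact loc_mul1 (M : lmodType R) :
  left_id (lfrac (1 : R^o) ldenom1) (@lfrac_mul M).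
Proof.
move=> x; have [m [s ->]] := lfracP x; rewrite lfrac_mulE scale1r.
by apply/eq_lfrac; exists 1; rewrite ?rpred1 //= mul1r.
Qed.

Fact loc_mulDl (M : lmodType R) (x : loc M) :
  {morph (@lfrac_mul M)^~ x : a b / a + b}.
Proof.
move=> a b; have [a' [s ->]] := lfracP a; have [b' [t ->]] := lfracP b.
have [m [r ->]] := lfracP x; rewrite lfracD !lfrac_mulE lfracD; apply/eq_lfrac.
exists 1; rewrite ?rpred1 //= !scale1r.
rewrite -[dval t *: a']/(dval t * a') -[dval s *: b']/(dval s * b').
by rewrite !scalerA -scalerDl !scalerA; congr (_ *: _); ring.
Qed.

Fact loc_mulDr (M : lmodType R) : right_distributive (@lfrac_mul M) +%R.
Proof.
move=> a x y; have [a' [s ->]] := lfracP a; have [m [t ->]] := lfracP x.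
have [n [r ->]] := lfracP y; rewrite lfracD !lfrac_mulE lfracD; apply/eq_lfrac.
exists 1; rewrite ?rpred1 //= !scale1r !scalerDr !scalerA.
by congr (_ *: _ + _ *: _); ring.
Qed.

Fact loc_ring_mulDl : left_distributive (@lfrac_mul R^o) +%R.
Proof. by move=> a b c; rewrite loc_mulDl. Qed.

HB.instance Definition _ := GRing.Zmodule_isComPzRing.Build loc_ring
  (@loc_mulA R^o) loc_mulC (@loc_mul1 R^o) loc_ring_mulDl.

HB.instance Definition _ (M : lmodType R) :=
  GRing.Zmodule_isLmodule.Build loc_ring (loc M)
    (@loc_mulA M) (@loc_mul1 M) (@loc_mulDr M) (@loc_mulDl M).

Definition ring_lfrac (a : R) (s : ldenom) : loc_ring := lfrac (a : R^o) s.

Lemma scale_lfrac (M : lmodType R) a s (m : M) t :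
  ring_lfrac a s *: lfrac m t = lfrac (a *: m) (ldenomM s t).
Proof. exact: lfrac_mulE. Qed.

End Localization.

Section LocalizedMap.
Variables (R : comPzRingType) (S : mulrClosed R) (N M : lmodType R).

Definition loc_map (h : {linear N -> M}) (y : loc S N) : loc S M :=
  lfrac (h (repr y).1) (repr y).2.

Lemma loc_mapE (h : {linear N -> M}) n (t : ldenom S) :
  loc_map h (lfrac n t) = lfrac (h n) t.
Proof.
rewrite /loc_map; have /eq_lfrac := lfrac_repr (lfrac n t).
case: (repr _) => [n' t'] /= [u Su e].
have {e} : h (u *: (dval t *: n')) = h (u *: (dval t' *: n)) by rewrite e.
by rewrite 4!linearZ => e; apply/eq_lfrac; exists u.
Qed.

Fact loc_map_is_linear (h : {linear N -> M}) : linear (loc_map h).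
Proof.
move=> a x y; have [a' [s ->]] := lfracP a; have [m [t ->]] := lfracP x.
have [n [r ->]] := lfracP y.
rewrite scale_lfrac lfracD !loc_mapE scale_lfrac lfracD linearD.
by congr (lfrac (_ + _) _); rewrite !(linearZ_LR h).
Qed.
HB.instance Definition _ (h : {linear N -> M}) :=
  GRing.isLinear.Build (loc_ring S) (loc S N) (loc S M) _ (loc_map h)
    (loc_map_is_linear h).

End LocalizedMap.
Arguments loc_map {R} S {N M} h y.

Section HomModule.
Variables (R : comPzRingType) (N M : lmodType R).
Implicit Types (f g h : {linear N -> M}).

Lemma linear_ext f g : f =1 g -> f = g.
Proof.
case: f g => [f [[f1] [f2]]] [g [[g1] [g2]]] /= /funext e.
by move: f1 f2 g1 g2; rewrite e => f1 f2 g1 g2;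
  rewrite (Prop_irrelevance f1 g1) (Prop_irrelevance f2 g2).
Qed.

Definition hom_zero : {linear N -> M} := \0.
Definition hom_opp f : {linear N -> M} := \- f.
Definition hom_add f g : {linear N -> M} := f \+ g.
Definition hom_scale (a : R) f : {linear N -> M} := a \*: f.

Fact hom_addA : associative hom_add.
Proof. by move=> f g h; apply: linear_ext => x /=; rewrite addrA. Qed.
Fact hom_addC : commutative hom_add.
Proof. by move=> f g; apply: linear_ext => x /=; rewrite addrC. Qed.
Fact hom_add0 : left_id hom_zero hom_add.
Proof. by move=> f; apply: linear_ext => x /=; rewrite add0r. Qed.
Fact hom_addN : left_inverse hom_zero hom_opp hom_add.
Proof. by move=> f; apply: linear_ext => x /=; rewrite addNr. Qed.

HB.instance Definition _ := GRing.isZmodule.Build {linear N -> M}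
  hom_addA hom_addC hom_add0 hom_addN.

Fact hom_scaleA a b f : hom_scale a (hom_scale b f) = hom_scale (a * b) f.
Proof. by apply: linear_ext => x /=; rewrite scalerA. Qed.
Fact hom_scale1 : left_id 1 hom_scale.
Proof. by move=> f; apply: linear_ext => x /=; rewrite scale1r. Qed.
Fact hom_scaleDr : right_distributive hom_scale +%R.
Proof. by move=> a f g; apply: linear_ext => x /=; rewrite scalerDr. Qed.
Fact hom_scaleDl f : {morph hom_scale^~ f : a b / a + b}.
Proof. by move=> a b; apply: linear_ext => x /=; rewrite scalerDl. Qed.

HB.instance Definition _ := GRing.Zmodule_isLmodule.Build R {linear N -> M}
  hom_scaleA hom_scale1 hom_scaleDr hom_scaleDl.

End HomModule.

Section InducedMap.
Variables (R : comPzRingType) (S : mulrClosed R) (N M : lmodType R).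

(* The map [(1 / s) h_S] attached to the fraction [h / s] of [Hom(N, M)]; it
   does not depend on the representative by [induced_mapE]. *)
Definition induced_map (x : loc S {linear N -> M}) : loc S N -> loc S M :=
  ring_lfrac 1 (repr x).2 \*: loc_map S (repr x).1.

Lemma induced_mapE h (s : ldenom S) y :
  induced_map (lfrac h s) y = ring_lfrac 1 s *: loc_map S h y.
Proof.
have [n [t ->]] := lfracP y; rewrite /induced_map /=.
have /eq_lfrac := lfrac_repr (lfrac h s).
case: (repr _) => [h' s'] /= [u Su e].
rewrite !loc_mapE !scale_lfrac !scale1r; apply/eq_lfrac; exists u => //=.
have {e} /= e : (u *: (dval s *: h')) n = (u *: (dval s' *: h)) n by rewrite e.
transitivity (dval t *: (u *: (dval s *: h' n))).
  by rewrite !scalerA; congr (_ *: _); ring.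
by rewrite e !scalerA; congr (_ *: _); ring.
Qed.

HB.instance Definition _ (x : loc S {linear N -> M}) :=
  GRing.Linear.on (induced_map x).

End InducedMap.

(* Main.v *)
Require Import Defs.
From HB Require Import structures.
From mathcomp Require Import all_boot all_algebra.
From mathcomp Require Import boolp ring.

Set Implicit Arguments.
Unset Strict Implicit.
Unset Printing Implicit Defensive.

Import GRing.Theory.
Local Open Scope ring_scope.

(** A linear map [g] on the Noetherian module [N] is injective as soon as it
    kills no [y] whose annihilator is an associated prime of [N].  Associated
    primes are treated one at a time, a maximal remaining one first: if [p] is
    the next one, some [a] outside [p] lies in all the primes already treated,
    so adding a multiple of [a] to [g] does not change it there.  With [h] good
    at [p], the corrected map is [g + a r (h - g)] when [a r = 1] modulo [p] for
    some [r]; otherwise the powers of [a] are distinct modulo [p] and some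
    [g + a ^+ j h] is good at [p], since eigenvectors of the pencil [(g, h)] for
    distinct eigenvalues are independent.  The process stops because a
    generator of [R / p] in [N] is never in the span of the previous ones. *)

(** * Spans of finite sequences and the ascending chain condition *)

Section Span.
Variables (R : comPzRingType) (N : lmodType R).
Implicit Types (x y z : N) (s : seq N).

Fixpoint span s z : Prop :=
  if s is y :: s' then exists r, span s' (z - r *: y) else z = 0.

Lemma span0 s : span s 0.
Proof. by elim: s => //= y s IH; exists 0; rewrite scale0r subr0. Qed.

Lemma span_lin s a x y : span s x -> span s y -> span s (a *: x + y).
Proof.
elim: s x y => [x y /= -> ->|z s IH x y /= [r sx] [t sy]].
  by rewrite scaler0 addr0.
exists (a * r + t); have := IH _ _ sx sy.
by rewrite scalerBr scalerA scalerDl opprD addrACA.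
Qed.

Lemma span_cons s x z : span s z -> span (x :: s) z.
Proof. by exists 0; rewrite scale0r subr0. Qed.

Lemma span_head s x : span (x :: s) x.
Proof. by exists 1; rewrite scale1r subrr; apply: span0. Qed.

Lemma span_closed s (P : N -> Prop) :
    P 0 -> (forall a x y, P x -> P y -> P (a *: x + y)) ->
    (forall z, z \in s -> P z) ->
  forall z, span s z -> P z.
Proof.
move=> P0 PD; elim: s => [_ z /= -> //|y s IH Ps z /= [r sz]].
have -> : z = r *: y + (z - r *: y) by rewrite addrC subrK.
apply: PD; first by apply: Ps; rewrite mem_head.
by apply: IH => // w sw; apply: Ps; rewrite inE sw orbT.
Qed.

(** Otherwise choice yields an endless chain of extensions with strictly growing spans, whose union
    is finitely generated and so equals one of them. With [P] arbitrary, this is the termination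
    argument of the later constructions. *)
Lemma noetherian_max_seq (noethN : noetherian N) (P : seq N -> Prop) :
  P [::] -> exists2 s, P s & forall x, P (x :: s) -> span s x.
Proof.
move=> P0; apply: contrapT => noP.
have ext (s : seq N) : exists x, P s -> P (x :: s) /\ ~ span s x.
  have [Ps|] := pselect (P s); last by exists 0.
  apply: contrapT => /forallNP nx; apply: noP; exists s => // x Px.
  by apply: contrapT => nsx; apply: (nx x).
have [f fP] := choice ext.
pose S n := iter n (fun s => f s :: s) [::].
have PS n : P (S n) by elim: n => //= n /fP[].
have Smono m n z : (m <= n)%N -> span (S m) z -> span (S n) z.
  move=> /subnKC <-; elim: (n - m)%N => [|k IH]; rewrite ?addn0 // addnS.
  by move=> /IH /(@span_cons _ (f (S (m + k)%N))).
pose U : {pred N} := fun z => `[< exists n, span (S n) z >].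
have [|t tP] := noethN U.
  split=> [|a x y /asboolP[m sx] /asboolP[n sy]].
    by apply/asboolP; exists 0%N; apply: span0.
  apply/asboolP; exists (maxn m n).
  by apply: span_lin; [apply: Smono sx | apply: Smono sy];
    rewrite ?leq_maxl ?leq_maxr.
have tU : {subset t <= U}.
  move=> z /(nthP 0)[i it <-]; apply/tP.
  exists (fun j => (j == Ordinal it)%:R).
  by rewrite (bigD1 (Ordinal it)) //= eqxx scale1r big1 ?addr0 // => j /negbTE ->;
    rewrite scale0r.
have [n nP] : exists n, forall z, z \in t -> span (S n) z.
  elim: t {tP} tU => [_|z t IH tU]; first by exists 0%N.
  have [|n nP] := IH; first by move=> w tw; apply: tU; rewrite inE tw orbT.
  have /asboolP[m mP] := tU z (mem_head _ _).
  exists (maxn m n) => w; rewrite inE => /predU1P[->|/nP].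
    by apply: Smono mP; rewrite leq_maxl.
  by apply: Smono; rewrite leq_maxr.
have : f (S n) \in U by apply/asboolP; exists n.+1; apply: span_head.
case/tP => c fE; have [_ []] := fP _ (PS n); rewrite fE.
elim/big_ind: _ => [|x y sx sy|i _]; first exact: span0.
  by rewrite -[x]scale1r; apply: span_lin.
by rewrite -[_ *: _]addr0; apply: span_lin; [apply/nP/mem_nth | apply: span0].
Qed.

End Span.

(** * Associated primes, represented by elements of [N] *)

Section AssociatedPrimes.
Variables (R : comPzRingType) (N : lmodType R).
Implicit Types (x y z e : N) (s : seq N) (a b r : R).

Definition ann_sub x y := forall a, a *: x = 0 -> a *: y = 0.

Definition ann_eq x y := ann_sub x y /\ ann_sub y x.

Definition prime_ann x :=
  x <> 0 /\ forall a b, (a * b) *: x = 0 -> a *: x = 0 \/ b *: x = 0.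

Lemma prime_annX {x} a n : prime_ann x -> a *: x <> 0 -> a ^+ n *: x <> 0.
Proof.
move=> [x0 xP] ax; elim: n => [|n IH]; first by rewrite scale1r.
by rewrite exprS => /xP[].
Qed.

(** For each [z] some element kills [z] but not [x]; by primality the product of these does not kill
    [x]. *)
Lemma prime_ann_avoid x s : prime_ann x -> (forall z, z \in s -> ~ ann_sub z x) ->
  exists2 a, a *: x <> 0 & forall z, z \in s -> a *: z = 0.
Proof.
move=> [x0 xP]; elim: s => [_|z s IH sP]; first by exists 1; rewrite ?scale1r.
have [|a ax aP] := IH; first by move=> w sw; apply: sP; rewrite inE sw orbT.
have /existsNP[b /not_implyP[bz bx]] := sP z (mem_head _ _).
exists (a * b) => [/xP[]//|w]; rewrite inE => /predU1P[->|/aP aw].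
  by rewrite -scalerA bz scaler0.
by rewrite mulrC -scalerA aw scaler0.
Qed.

Lemma span_ann s a z : (forall w, w \in s -> a *: w = 0) -> span s z -> a *: z = 0.
Proof.
move=> sP; apply: (span_closed (P := fun w => a *: w = 0)) => //=.
  by rewrite scaler0.
by move=> b x y ax ay; rewrite scalerDr scalerA mulrC -scalerA ax ay scaler0 addr0.
Qed.

Hypothesis noethN : noetherian N.

(* Only ideals containing [ann e] enjoy the ascending chain condition for free,
   through [R / ann e = R e], since [R] need not be Noetherian. *)
Lemma max_ann (Q : N -> Prop) e x0 : ann_sub e x0 -> Q x0 ->
  exists x, [/\ Q x, ann_sub x0 x
    & forall y, Q y -> ann_sub x y -> ann_sub y x].
Proof.
move=> ex0 Qx0.
(* [s] collects elements of the image in [R e] of the annihilator of [x]; once its span cannot grow,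
   that annihilator is maximal. *)
pose P s := exists x, [/\ Q x, ann_sub x0 x
  & forall z, z \in s -> exists2 b, z = b *: e & b *: x = 0].
have [|s [x [Qx x0x sP]] smax] := noetherian_max_seq noethN (P := P).
  by exists x0; split.
exists x; split=> // y Qy xy b yb0.
have : span s (b *: e).
  apply: smax; exists y; split=> // [a /x0x/xy //|z].
  by rewrite inE => /predU1P[->|/sP[c -> /xy]]; [exists b | exists c].
move/(@span_closed _ _ s (fun z => exists2 b, z = b *: e & b *: x = 0)).
case=> [|a u v [c -> cx] [d -> dx]|//|c bc cx].
- by exists 0; rewrite scale0r.
- exists (a * c + d); first by rewrite scalerDl scalerA.
  by rewrite scalerDl -scalerA cx dx scaler0 addr0.
have /ex0/x0x : (b - c) *: e = 0 by rewrite scalerBl bc subrr.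
by rewrite scalerBl cx subr0.
Qed.

(** A maximal annihilator of nonzero elements of [K] is prime: if [a b] kills [x] and [b x] is
    nonzero, the annihilator of [b x] contains [a] and that of [x], hence equals the latter. *)
Lemma exists_prime_ann (K : N -> Prop) y :
    (forall a z, K z -> K (a *: z)) -> K y -> y <> 0 ->
  exists2 x, prime_ann x & K x.
Proof.
move=> KZ Ky y0.
have [//|//|x [[Kx x0] _ xmax]] := @max_ann (fun z => K z /\ z <> 0) y y.
exists x => //; split=> // a b abx.
have [|bx] := pselect (b *: x = 0); [by right | left].
apply: (xmax (b *: x)) => //; first by split=> //; apply: KZ.
  by move=> c cx; rewrite scalerA mulrC -scalerA cx scaler0.
by rewrite scalerA.
Qed.

Lemma max_prime_ann (Q : N -> Prop) x0 : prime_ann x0 -> Q x0 ->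
  exists x, [/\ prime_ann x, Q x
    & forall y, prime_ann y -> Q y -> ann_sub x y -> ann_sub y x].
Proof.
move=> px0 Qx0.
have [|t tP] := noethN (U := predT); first by split.
have [e ex0] : exists e, ann_sub e x0.
  apply: contrapT => /forallNP noe.
  have [a ax aP] := prime_ann_avoid px0 (fun z (_ : z \in t) => noe z).
  have [c x0E] := (tP x0).1 isT; apply: ax; rewrite x0E scaler_sumr big1 // => i _.
  by rewrite scalerA mulrC -scalerA aP ?scaler0 ?mem_nth.
have [//|x [[px Qx] _ xmax]] := @max_ann (fun z => prime_ann z /\ Q z) e x0 ex0.
by exists x; split=> // y py Qy; apply: xmax.
Qed.

End AssociatedPrimes.

(** * Maps good at an associated prime, and their correction *)

Section GoodMaps.
Variables (R : comPzRingType) (N M : lmodType R).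
Hypothesis noethN : noetherian N.
Implicit Types (x y z : N) (g h : {linear N -> M}) (a : R).

Definition good_at g x := forall y, ann_eq x y -> g y <> 0.

(** Were [z] killed only by elements killing [x], the two annihilators would agree, against
    goodness. *)
Lemma good_at_torsion g x z : prime_ann x -> good_at g x -> ann_sub x z ->
  g z = 0 -> exists2 u, u *: x <> 0 & u *: z = 0.
Proof.
move=> px gx xz gz; apply: contrapT => nou; apply: (gx z) => //; split=> // u uz.
by apply: contrapT => ux; apply: nou; exists u.
Qed.

Lemma pencil_independent g h x (t : nat -> R) (Y : nat -> N) n (c : nat -> R) :
    prime_ann x -> good_at h x ->
    (forall i j, (i < j)%N -> (t j - t i) *: x <> 0) ->
    (forall i, ann_eq x (Y i) /\ g (Y i) + t i *: h (Y i) = 0) ->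
    \sum_(i < n) c i *: Y i = 0 ->
  forall i, (i < n)%N -> c i *: x = 0.
Proof.
move=> px hx tX YP; elim: n c => // n IH c; rewrite big_ord_recr /= => sum0.
set z := \sum_(i < n) c i *: Y i in sum0.
(* By [sum0], [z] is a multiple of [Y n], which [g + t n h] kills. *)
have gh0 : g z + t n *: h z = 0.
  have [_ YE] := YP n.
  have -> : z = (- c n) *: Y n by rewrite scaleNr; apply/eqP; rewrite -addr_eq0 sum0.
  by rewrite (linearZ_LR g) (linearZ_LR h) scalerA mulrC -scalerA -scalerDr YE scaler0.
(* As [g (Y i) = - t i h (Y i)], the value of [g + t n h] at [z] is [h w]. *)
pose w := \sum_(i < n) (c i * (t n - t i)) *: Y i.
have hw : h w = 0.
  rewrite -gh0 /w /z (linear_sum g) !(linear_sum h) scaler_sumr -big_split /=.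
  apply: eq_bigr => i _; have [_ YE] := YP i.
  rewrite (linearZ_LR g) !(linearZ_LR h) (_ : g (Y i) = - (t i *: h (Y i))).
    by rewrite scalerN !scalerA -scaleNr -scalerDl; congr (_ *: _); ring.
  by apply/eqP; rewrite -addr_eq0 YE.
have xw : ann_sub x w.
  move=> b bx; rewrite /w scaler_sumr big1 // => i _.
  by rewrite scalerA mulrC -scalerA (YP i).1.1 ?scaler0.
(* [w] itself need not vanish, but [u w = 0] is a relation among the first [n] vectors, open to
   induction. *)
have [u ux uw] := good_at_torsion px hx xw hw.
have c0 i : (i < n)%N -> c i *: x = 0.
  move=> lt_in; have := IH (fun i => u * (c i * (t n - t i))) _ i lt_in.
  case/(_ _)/px.2 => [|//|/px.2[]//]; last by move/(tX _ _ lt_in).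
  by rewrite -[RHS]uw /w scaler_sumr; apply: eq_bigr => j _; rewrite scalerA.
have z0 : z = 0 by rewrite /z big1 // => i _; apply/(YP i).1.1/c0.
move=> i; rewrite ltnS leq_eqVlt => /predU1P[->|/c0//].
by apply: (YP n).1.2; move: sum0; rewrite z0 add0r.
Qed.

(** If every [j] failed, the witnesses [Y j] would be independent in the above sense, whereas some
    [Y n] is a combination of the earlier ones because [N] is Noetherian. *)
Lemma pencil_good g h x (t : nat -> R) : prime_ann x -> good_at h x ->
    (forall i j, (i < j)%N -> (t j - t i) *: x <> 0) ->
  exists j, good_at (hom_add g (hom_scale (t j) h)) x.
Proof.
move=> px hx tX; apply: contrapT => /forallNP nogood.
have bad j : exists y, ann_eq x y /\ g y + t j *: h y = 0.
  by have /existsNP[y /not_implyP[xy /contrapT]] := nogood j; exists y.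
have [Y YP] := choice bad.
pose P s := exists n, s = rev (mkseq Y n).
have [|_ [n ->] smax] := noetherian_max_seq noethN (P := P); first by exists 0%N.
have /smax : P (Y n :: rev (mkseq Y n)).
  by exists n.+1; rewrite /mkseq -addn1 iotaD map_cat rev_cat.
have spanE m z : span (rev (mkseq Y m)) z ->
    exists c : nat -> R, z = \sum_(i < m) c i *: Y i.
  elim: m z => [z -> | m IH z]; first by exists (fun=> 0); rewrite big_ord0.
  rewrite /mkseq -addn1 iotaD map_cat rev_cat => -[r /IH[c cE]].
  exists (fun i => if i == m then r else c i).
  rewrite addn1 big_ord_recr /= eqxx -[LHS](subrK (r *: Y m)) cE.
  by congr (_ + _); apply: eq_bigr => i _; rewrite ltn_eqF.
case/spanE => c YnE.
have := pencil_independent (n := n.+1)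
  (c := fun i => if i == n then -1 else c i) px hx tX YP.
move=> /(_ _ n (ltnSn n)); rewrite eqxx scaleN1r => x0.
apply: px.1; apply/eqP; rewrite -oppr_eq0; apply/eqP/x0.
rewrite big_ord_recr /= eqxx scaleN1r; apply/eqP; rewrite subr_eq0 YnE; apply/eqP.
by apply: eq_bigr => i _; rewrite ltn_eqF.
Qed.

Lemma good_at_correct g h x a : prime_ann x -> good_at h x -> a *: x <> 0 ->
  exists2 g' : {linear N -> M},
    good_at g' x & forall y, a *: y = 0 -> g' y = g y.
Proof.
move=> px hx ax.
have [[r arx]|nor] := pselect (exists r, (1 - a * r) *: x = 0).
  (* Here [a r] fixes every [y] with the annihilator of [x], so the new map agrees with [h]
     there. *)
  exists (hom_add g (hom_scale (a * r) (hom_add h (hom_opp g)))) => [y xy|y ay] /=.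
    have ary : (a * r) *: y = y.
      by apply/esym/eqP; rewrite -subr_eq0 -{1}[y]scale1r -scalerBl; apply/eqP/xy.1.
    rewrite scalerDr scalerN -(linearZ_LR h) -(linearZ_LR g) ary.
    by rewrite addrCA subrr addr0; apply: hx.
  rewrite mulrC -scalerA scalerDr scalerN -(linearZ_LR h) -(linearZ_LR g) ay.
  by rewrite (linear0 h) (linear0 g) subr0 scaler0 addr0.
(* The exponent [j.+1] keeps a factor [a], so the correction vanishes on every [y] killed by [a]. *)
have [i j lt_ij|j gj] := pencil_good (t := fun j => a ^+ j.+1) g px hx.
  have -> : a ^+ j.+1 - a ^+ i.+1 = - (a ^+ i.+1 * (1 - a * a ^+ (j - i).-1)).
    rewrite -exprS prednK ?subn_gt0 // mulrBr mulr1 -exprD opprB addSn subnKC //.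
    exact: ltnW.
  rewrite scaleNr => /eqP; rewrite oppr_eq0 => /eqP/px.2[].
    exact: prime_annX.
  by move=> e; apply: nor; exists (a ^+ (j - i).-1).
exists (hom_add g (hom_scale (a ^+ j.+1) h)) => // y ay /=.
by rewrite exprSr -scalerA -(linearZ_LR h) ay linear0 scaler0 addr0.
Qed.

Lemma exists_injective :
    (forall x, prime_ann x -> exists h : {linear N -> M}, good_at h x) ->
  exists h : {linear N -> M}, injective h.
Proof.
move=> local.
(* A prime containing a treated one must be treated too; this is what lets prime avoidance apply to
   an untreated [x]. *)
pose P (s : seq N) := [/\ forall x, x \in s -> prime_ann x,
  forall x y, x \in s -> prime_ann y -> ann_sub x y ->
    exists2 z, z \in s & ann_eq z y
  & exists g : {linear N -> M}, forall x, x \in s -> good_at g x].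
have [|s [sp sup [g gs]] smax] := noetherian_max_seq noethN (P := P).
  by split=> //; exists (hom_zero N M).
suff sfull x : prime_ann x -> exists2 z, z \in s & ann_eq z x.
  have gK a z : g z = 0 -> g (a *: z) = 0.
    by rewrite (linearZ_LR g) => ->; rewrite scaler0.
  exists g => y z /eqP; rewrite -subr_eq0 -linearB => /eqP gyz.
  apply/eqP; rewrite -subr_eq0; apply/eqP; apply: contrapT => yz0.
  have [x px gx] := exists_prime_ann noethN gK gyz yz0.
  by have [w ws wx] := sfull x px; apply: gs ws _ wx gx.
move=> px0; apply: contrapT => nox0.
pose Q x := ~ exists2 z, z \in s & ann_eq z x.
have [{px0 nox0}x [px Qx xmax]] := max_prime_ann noethN (Q := Q) px0 nox0.
have [|a ax as0] := prime_ann_avoid (s := s) px.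
  by move=> z zs /(sup z x zs px)/Qx.
have [h hx] := local x px.
have [g' g'x g'E] := good_at_correct g px hx ax.
(* [a] kills the span of [s] but not [x], so [P (x :: s)] would contradict the maximality of [s]. *)
apply/ax/(span_ann as0)/smax; split=> [y|y z|].
- by rewrite inE => /predU1P[->|/sp].
- have [[w ws wz] _ _ _|Qz] := pselect (exists2 w, w \in s & ann_eq w z).
    by exists w; rewrite // inE ws orbT.
  rewrite inE => /predU1P[-> pz xz|ys pz yz]; last by case: Qz; apply: sup yz.
  (* An untreated prime containing that of [x] equals it, by the maximal choice of [x]. *)
  by exists x; rewrite ?mem_head //; split=> //; apply: xmax.
exists g' => y; rewrite inE => /predU1P[-> //|ys z yz].
by rewrite g'E; [apply: gs yz | apply/yz.1/as0].
Qed.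

End GoodMaps.

(** * Passage between maps and their localizations *)

Section Localization.
Variables (R : comPzRingType) (N M : lmodType R).

Lemma ann_prime_ideal (x : N) : prime_ann x ->
  is_prime_ideal [pred a : R | `[< a *: x = 0 >]].
Proof.
move=> [x0 xP]; split=> [||a u v|u v]; rewrite ?inE.
- by apply/asboolP; rewrite scale0r.
- by apply/asboolP; rewrite scale1r.
- move=> /asboolP ux /asboolP vx; apply/asboolP.
  by rewrite scalerDl -scalerA ux vx scaler0 addr0.
by move=> /asboolP/xP[] ?; apply/orP; [left | right]; apply/asboolP.
Qed.

(** Localize at the annihilator [p] of [x]: if [h] killed [y], injectivity would give [y / 1 = 0],
    so some [u] outside [p] would kill [y] and hence [x]. *)
Lemma local_good_at (x : N) : prime_ann x ->
    (forall p : prime_ideal R,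
      exists f : loc (prime_compl p) {linear N -> M}, injective (induced_map f)) ->
  exists h : {linear N -> M}, good_at h x.
Proof.
move=> px local; pose p := PrimeIdeal (ann_prime_ideal px).
have [f finj] := local p; have [h [s fE]] := lfracP f.
exists h => y [_ yx] hy0.
have /lfrac_eq0[u] : lfrac y (ldenom1 (prime_compl p)) = 0.
  apply: finj; rewrite fE !induced_mapE loc_mapE hy0 lfrac0.
  by rewrite (linear0 (loc_map (prime_compl p) h)).
by rewrite !inE => /asboolP ux /yx.
Qed.

Lemma induced_map_inj (S : mulrClosed R) (h : {linear N -> M}) :
  injective h -> injective (induced_map (lfrac h (ldenom1 S))).
Proof.
move=> hinj y z /eqP; rewrite -subr_eq0 -linearB => /eqP e; apply/eqP.
rewrite -subr_eq0; move: e; have [n [t ->]] := lfracP (y - z).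
rewrite /= induced_mapE loc_mapE scale_lfrac scale1r => /lfrac_eq0[u Su uh].
apply/eqP/lfrac_eq0; exists u => //; apply: hinj.
by rewrite linear0 (linearZ_LR h).
Qed.

End Localization.

Unset Implicit Arguments.

Theorem theorem1p1 (R : comPzRingType) (M N : lmodType R)
    (noethN : noetherian N) :
  (exists h : {linear N -> M}, injective h) <->
  (forall p : prime_ideal R,
    exists x : loc (prime_compl p) {linear N -> M}, injective (induced_map x)).
Proof.
split=> [[h hinj] p|local].
  by exists (lfrac h (ldenom1 _)); apply: induced_map_inj.
by apply: exists_injective => // x px; apply: local_good_at.
Qed.
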